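(* Let $\Delta$ be a Stonean space, $(\Delta,\{H_s\}_{s\in\Delta},\Omega)$ a continuous Hilbert bundle and $\Omega_{\rm wk}$ the associated module of bounded weakly continuous vector fields. With respect to the inclusion $\Omega\subset\Omega_{\rm wk}$, we have $\Omega^\perp=\{0\}$, where $\Omega^\perp=\{\nu\in\Omega_{\rm wk}:\langle\nu,\omega\rangle=0\text{ for all }\omega\in\Omega\}$.
   Context: A Stonean space is a compact, Hausdorff, extremally disconnected space. Inner products are linear in the first variable. A vector field on $\Delta$ with fibres $H_s$ (complex Hilbert spaces) is a function $\nu:\Delta\to\bigsqcup_s H_s$ with $\nu(s)\in H_s$ for all $s$. A continuous Hilbert bundle $(\Delta,\{H_s\}_{s\in\Delta},\Omega)$ consists of a set $\Omega$ of such vector fields such that: (I) $\Omega$ is a $C(\Delta)$-module under $(f\cdot\omega)(s)=f(s)\omega(s)$; (II) $\{\omega(s_0):\omega\in\Omega\}=H_{s_0}$ for every $s_0\in\Delta$; (III) $s\mapsto\|\omega(s)\|$ is continuous for every $\omega\in\Omega$; (IV) $\Omega$ is closed under local uniform approximation: if $\xi$ is a vector field such that for every $s_0\in\Delta$ and $\varepsilon>0$ there are an open set $U\ni s_0$ and $\omega\in\Omega$ with $\|\omega(s)-\xi(s)\|<\varepsilon$ for all $s\in U$, then $\xi\in\Omega$. A vector field $\nu$ is weakly continuous (with respect to $\Omega$) if $s\mapsto\langle\nu(s),\omega(s)\rangle$ is continuous for every $\omega\in\Omega$. $\Omega_{\rm wk}$ is the set of all weakly continuous $\nu$ with $\sup_s\|\nu(s)\|<\infty$.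 It carries the $C(\Delta)$-valued inner product for which $\langle\nu_1,\nu_2\rangle$ is the unique function in $C(\Delta)$ agreeing with $s\mapsto\langle\nu_1(s),\nu_2(s)\rangle$ off some meagre set; if $\nu_2\in\Omega$ then $\langle\nu_1,\nu_2\rangle(s)=\langle\nu_1(s),\nu_2(s)\rangle$ for all $s$. *)

(* Defs.v *)
From HB Require Import structures.
From mathcomp Require Import all_boot all_order all_algebra.
From mathcomp Require Import complex.
From mathcomp Require Import all_classical all_reals all_analysis.

Set Implicit Arguments.
Unset Strict Implicit.
Unset Printing Implicit Defensive.

Import Order.TTheory GRing.Theory Num.Theory.
Import numFieldNormedType.Exports.

Local Open Scope classical_set_scope.
Local Open Scope ring_scope.

(* Norms over R[i] take values in R[i], where [0 < e] and [0 <= e] include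
   that [e] is real.  [R[i]^o] is R[i] with the topology of its modulus. *)

(* [{dot V for conjC}] is linear in its first argument and conjugate-linear in
   its second one. *)
HB.mixin Record isHilbert (R : realType) V
    of CompleteNormedModule R[i] V := {
  hdot : {dot V for (@Num.conj R[i])} ;
  hdot_norm : forall x : V, hdot x x = `|x| ^+ 2
}.

#[short(type="hilbertType")]
HB.structure Definition Hilbert (R : realType) :=
  {V of CompleteNormedModule R[i] V & isHilbert R V}.

Definition extremally_disconnected (T : topologicalType) : Prop :=
  forall U : set T, open U -> open (closure U).

Record stonean (T : topologicalType) : Prop := Stonean {
  stonean_compact : compact [set: T] ;
  stonean_hausdorff : hausdorff_space T ;
  stonean_extremally_disconnected : extremally_disconnected T
}.

Definition nowhere_dense (T : topologicalType) (A : set T) : Prop :=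
  (closure A)° = set0.

Definition meagre (T : topologicalType) (A : set T) : Prop :=
  exists2 F : nat -> set T,
    forall n, nowhere_dense (F n) & A `<=` \bigcup_n F n.

Definition vfield (R : realType) (T : topologicalType) (H : T -> hilbertType R) :=
  forall s : T, H s.

Section HilbertBundle.
Context {R : realType} {T : topologicalType} {H : T -> hilbertType R}.
Implicit Types (Omega : set (vfield H)) (nu omega xi : vfield H).

Definition vfield0 : vfield H := fun=> 0.

Definition vfield_add nu1 nu2 : vfield H := fun s => nu1 s + nu2 s.

Definition vfield_scale (f : T -> R[i]^o) nu : vfield H :=
  fun s => (f s : R[i]) *: nu s.

(* Additive inverses come from scaling by the constant -1. *)
Record continuous_hilbert_bundle Omega : Prop := ContinuousHilbertBundle {
  bundle0 : Omega vfield0 ;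
  bundleD : forall omega1 omega2,
    Omega omega1 -> Omega omega2 -> Omega (vfield_add omega1 omega2) ;
  bundleZ : forall (f : T -> R[i]^o) omega,
    continuous f -> Omega omega -> Omega (vfield_scale f omega) ;
  bundle_fibre : forall s0 : T,
    [set omega s0 | omega in Omega] = [set: H s0] ;
  bundle_norm : forall omega, Omega omega ->
    continuous (fun s => `|omega s| : R[i]^o) ;
  bundle_closed : forall xi,
    (forall (s0 : T) (e : R[i]), 0 < e ->
      exists (U : set T) (omega : vfield H),
        [/\ open U, U s0, Omega omega &
            forall s, U s -> `|omega s - xi s| < e]) ->
    Omega xi
}.

Definition weakly_continuous Omega nu : Prop :=
  forall omega, Omega omega ->
    continuous (fun s => hdot (nu s) (omega s) : R[i]^o).

Definition bounded_vfield nu : Prop :=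
  exists M : R[i], forall s, `|nu s| <= M.

Definition Omega_wk Omega : set (vfield H) :=
  [set nu | weakly_continuous Omega nu /\ bounded_vfield nu].

Definition is_cinner nu1 nu2 (g : T -> R[i]^o) : Prop :=
  continuous g /\
  exists2 M : set T, meagre M & forall s, ~ M s -> g s = hdot (nu1 s) (nu2 s).

(* The C(T)-valued inner product on [Omega_wk Omega]: the only [g] such that
   [is_cinner nu1 nu2 g].  When T is Stonean and both arguments belong to
   [Omega_wk Omega] such a [g] exists and is unique, so that the default value
   0 of [xget] is not used. *)
Definition cinner nu1 nu2 : T -> R[i]^o := xget (cst 0) (is_cinner nu1 nu2).

Definition bundle_perp Omega : set (vfield H) :=
  [set nu | Omega_wk Omega nu /\
            forall omega, Omega omega -> cinner nu omega = cst 0].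

End HilbertBundle.

Arguments vfield0 {R T} H.

(* Main.v *)
Require Import Defs.
From mathcomp Require Import all_boot all_order all_algebra.
From mathcomp Require Import complex.
From mathcomp Require Import all_classical all_reals all_analysis.

(** A field orthogonal to [Omega] must vanish at every point [s0]: some
    [omega] in [Omega] takes the value [nu s0] at [s0], so [`|nu s0| ^+ 2] is
    the value at [s0] of the function [s |-> hdot (nu s) (omega s)].  This
    function is continuous because [nu] is weakly continuous, hence it is the
    [C(Delta)]-valued inner product [cinner nu omega], which is zero.

    The identification of [cinner] with the pointwise inner product
    ([cinner_eq]) rests on the uniqueness of the continuous function that
    agrees with it off a meagre set ([eq_continuous_off_meagre]): two
    continuous functions into a Hausdorff space that differ at one point differ
    on a nonempty open set, and by the Baire category theorem for compact
    Hausdorff spaces ([compact_Baire]) such a set is not meagre.  The same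
    uniqueness shows that the zero field is orthogonal to [Omega]. *)

Import GRing.Theory Num.Theory.

Local Open Scope classical_set_scope.
Local Open Scope ring_scope.

(** The interior of the closure of [A] is empty, so [W] has a point outside
    this closure, and by regularity that point has a neighbourhood whose closure
    stays inside [W] and away from [A]. *)
Lemma open_shrink_nowhere_dense (T : topologicalType) (A W : set T) :
  compact [set: T] -> hausdorff_space T -> nowhere_dense A ->
  open W -> W !=set0 ->
  exists W' : set T, [/\ open W', W' !=set0 & closure W' `<=` W `\` A].
Proof.
move=> cT hT ndA oW [w Ww].
have [x [Wx nAx]] : exists x, W x /\ ~ closure A x.
  apply: contrapT => nx.
  suff : (closure A)° w by rewrite ndA.
  apply: (filterS (P := W)); last exact: open_nbhs_nbhs.
  by move=> y Wy; apply: contrapT => nAy; apply: nx; exists y.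
have WAx : nbhs x (W `\` closure A).
  apply: open_nbhs_nbhs; split=> //; rewrite setDE.
  by apply: openI => //; apply: closed_openC; apply: closed_closure.
have [V Vx VWA] := compact_regular hT cT filterT WAx.
exists V°; split; first exact: open_interior.
  by exists x.
move=> y /(closure_subset (@interior_subset _ V)) /VWA [Wy nAy].
by split=> // /subset_closure.
Qed.

(** Starting from a nonempty open set [O], shrinking repeatedly gives nonempty
    open sets, each containing the closure of the next, that avoid one nowhere
    dense set after another; compactness provides a point common to all these
    closures. *)
Lemma compact_Baire (T : topologicalType) (M : set T) :
  compact [set: T] -> hausdorff_space T -> meagre M -> dense (~` M).
Proof.
move=> cT hT [F ndF MF] O O0 oO.
(* Nonemptiness and openness travel with the sets, so that one shrinking step
   can be chosen for every such set and then iterated by plain recursion. *)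
pose nonempty_open := {W : set T | open W /\ W !=set0}.
have step n (W : nonempty_open) :
    {W' : nonempty_open | closure (sval W') `<=` sval W `\` F n}.
  apply: cid; case: W => W [oW W0] /=.
  have [W' [oW' W'0 W'W]] := open_shrink_nowhere_dense _ _ _ cT hT (ndF n) oW W0.
  by exists (exist _ W' (conj oW' W'0)).
pose W := fix W n : nonempty_open :=
  if n is m.+1 then sval (step m (W m)) else exist _ O (conj oO O0).
have WS n : closure (sval (W n.+1)) `<=` sval (W n) `\` F n.
  exact: (svalP (step n (W n))).
have Wle m n : (m <= n)%N -> sval (W n) `<=` sval (W m).
  elim: n => [|n IH]; first by rewrite leqn0 => /eqP ->.
  rewrite leq_eqVlt => /predU1P[-> //|/IH Wnm] x /subset_closure /WS [Wnx _].
  exact: Wnm.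
pose G : set_system T := filter_from [set: nat] (fun n => sval (W n)).
have PG : ProperFilter G.
  apply: filter_from_proper; last by move=> n _; case: (svalP (W n)).
  apply: filter_from_filter; first by exists 0%N.
  move=> m n _ _; exists (maxn m n) => // x Wx.
  by split; apply: Wle Wx; rewrite ?leq_maxl ?leq_maxr.
have [p [_]] := cT G PG filterT.
rewrite clusterE => Gp.
have Wp n : closure (sval (W n)) p by apply: Gp; exists n.
exists p; split; first by case: (WS 0%N p (Wp 1%N)).
by move=> /MF [n _ Fnp]; case: (WS n p (Wp n.+1)).
Qed.

(** If [f x] and [g x] are separated by disjoint open sets [U] and [V], the open
    neighbourhood of [x] where [f] lies in [U] and [g] in [V] would have to be
    contained in [M], against Baire's theorem. *)
Lemma eq_continuous_off_meagre (T Y : topologicalType) (M : set T)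
    (f g : T -> Y) :
  compact [set: T] -> hausdorff_space T -> hausdorff_space Y ->
  continuous f -> continuous g -> meagre M ->
  (forall s, ~ M s -> f s = g s) -> f = g.
Proof.
move=> cT hT hY cf cg mM fgM; apply/funext => x.
apply: contrapT => /eqP fgx.
move: hY; rewrite open_hausdorff => /(_ _ _ fgx) [[U V]] /=.
move=> [/set_mem Ufx /set_mem Vgx] [oU oV /eqP/seteqP[UV0 _]].
have [||s [[Us Vs] Ms]] := compact_Baire _ _ cT hT mM (f @^-1` U `&` g @^-1` V).
- by exists x.
- by apply: openI; apply: open_comp.
- by apply: (UV0 (f s)); split => //; rewrite fgM.
Qed.

Lemma meagre0 (T : topologicalType) : meagre (set0 : set T).
Proof.
exists (fun=> set0); last exact: sub0set.
by move=> _; rewrite /nowhere_dense closure0 interior0.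
Qed.

(** The pointwise inner product is itself a candidate in the choice defining
    [cinner], with empty exceptional set; by uniqueness it is the chosen one. *)
Lemma cinner_eq (R : realType) (T : topologicalType) (H : T -> hilbertType R)
    (nu1 nu2 : vfield H) :
  compact [set: T] -> hausdorff_space T ->
  continuous (fun s => hdot (nu1 s) (nu2 s) : R[i]^o) ->
  cinner nu1 nu2 = (fun s => hdot (nu1 s) (nu2 s)).
Proof.
move=> cT hT cdot.
have [|cg [M mM gM]] := @xgetPex _ (cst 0) (is_cinner nu1 nu2).
  exists (fun s => hdot (nu1 s) (nu2 s)); split=> //.
  by exists set0 => //; exact: meagre0.
by apply: (eq_continuous_off_meagre _ _ M).
Qed.

Theorem lemma3p4 (R : realType) (Delta : topologicalType)
    (H : Delta -> hilbertType R) (Omega : set (vfield H)) :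
  stonean Delta -> continuous_hilbert_bundle Omega ->
  bundle_perp Omega = [set vfield0 H].
Proof.
move=> [cD hD _] bundleOmega; apply/seteqP; split=> nu /=.
  move=> [[wc_nu _] nu_perp]; apply: functional_extensionality_dep => s0.
  have [omega Oomega omega_s0] : [set omega s0 | omega in Omega] (nu s0).
    by rewrite bundle_fibre.
  have := nu_perp _ Oomega; rewrite cinner_eq //; last exact: wc_nu.
  move=> /(congr1 (@^~ s0)); rewrite omega_s0 hdot_norm => /eqP.
  by rewrite sqrf_eq0 normr_eq0 => /eqP.
move=> ->.
have dot0 (omega : vfield H) :
    (fun s => hdot (vfield0 H s) (omega s) : R[i]^o) = cst 0.
  by apply/funext => s; rewrite linear0l.
split; [split|].
- by move=> omega _; rewrite dot0; exact: cst_continuous.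
- by exists 0 => s; rewrite normr0.
- move=> omega _; rewrite cinner_eq // dot0 //; exact: cst_continuous.
Qed.
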